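(* Let $H$ be a graph with $h\ge 3$ vertices and at least two edges. Then there is a constant $c=c(H)>0$ such that for every (finite or infinite) field $\mathbb{F}$ and every integer $n\ge 2$ there is a graph $G$ on $n$ vertices whose complement contains no copy of $H$ (as a subgraph) and $$\operatorname{minrank}_{\mathbb{F}}(G)\ \ge\ c\,\frac{n^{1-1/m_2(H)}}{\log n}.$$
   Context: For a graph $G$ on vertex set $[n]$ and a field $\mathbb{F}$, $\operatorname{minrank}_{\mathbb{F}}(G)$ is the minimum rank of a matrix $M\in\mathbb{F}^{n\times n}$ with all diagonal entries nonzero such that $M_{i,j}=0$ whenever $i\neq j$ and $i,j$ are nonadjacent in $G$. For a graph $H$ with at least $3$ vertices, $m_2(H)$ is the maximum of $\frac{f'-1}{h'-2}$ over all subgraphs $H'$ of $H$ with $h'\ge 3$ vertices and $f'$ edges. *)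

(* Defs.v *)
From HB Require Import structures.
From mathcomp Require Import all_boot all_order all_algebra.
From Stdlib Require Import Reals ClassicalEpsilon.

Set Implicit Arguments.
Unset Strict Implicit.
Unset Printing Implicit Defensive.

Definition simple_graph (T : finType) (e : rel T) : Prop :=
  symmetric e /\ irreflexive e.

Definition edge_set (T : finType) (e : rel T) : {set {set T}} :=
  [set A : {set T} | [exists x, exists y, [&& x != y, e x y & A == [set x; y]]]].

Definition compl_graph (T : finType) (e : rel T) : rel T :=
  fun x y => (x != y) && ~~ e x y.

Definition contains_copy (TH TG : finType) (eH : rel TH) (eG : rel TG) : Prop :=
  exists f : TH -> TG, injective f /\ forall x y, eH x y -> eG (f x) (f y).

Definition is_subgraph (T : finType) (e : rel T) (S : {set T}) (F : {set {set T}}) : bool :=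
  (F \subset edge_set e) && [forall A in F, A \subset S].

Definition dens2 (T : finType) (S : {set T}) (F : {set {set T}}) : R :=
  Rdiv (Rminus (INR #|F|) 1) (Rminus (INR #|S|) 2).

(* m_2(H) = max over subgraphs with at least 3 vertices of (f'-1)/(h'-2).
   The fold starts at 0, which is harmless whenever H has an edge pair
   (then the true maximum is >= 1/2 > 0). *)
Definition m2 (T : finType) (e : rel T) : R :=
  \big[Rmax/0%R]_(p : {set T} * {set {set T}} |
                   (3 <= #|p.1|)%N && is_subgraph e p.1 p.2) dens2 p.1 p.2.

Definition fits (F : fieldType) (n : nat) (G : rel 'I_n) (M : 'M[F]_n) : Prop :=
  (forall i, M i i != (GRing.zero : F)) /\ (forall i j, i != j -> ~~ G i j -> M i j = (GRing.zero : F)).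

Definition has_fit_rank (F : fieldType) (n : nat) (G : rel 'I_n) (r : nat) : bool :=
  if excluded_middle_informative (exists M : 'M[F]_n, fits G M /\ \rank M = r)
  then true else false.

Lemma has_fit_rank_ex (F : fieldType) (n : nat) (G : rel 'I_n) :
  exists r, has_fit_rank F G r.
Proof.
exists n; rewrite /has_fit_rank.
case: excluded_middle_informative => // [[]].
exists (scalar_mx (GRing.one F)); split; last by rewrite mxrank1.
split=> [i|i j ij _]; first by rewrite mxE eqxx GRing.oner_neq0.
by rewrite mxE (negbTE ij).
Qed.

Definition minrank (F : fieldType) (n : nat) (G : rel 'I_n) : nat :=
  ex_minn (has_fit_rank_ex F G).

(* Main.v *)
(** The complement of [G] is a sparse [H]-free graph [Q'] obtained from a random
    set [Q] of pairs of density [q = eps * n ^ (- 1 / m_2(H))] by deleting a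
    maximal family of edge-disjoint copies of a subgraph of [H] attaining
    [m_2(H)].  A fixed set of [s] pairs misses [Q'] with probability at most
    [exp (- q s / 2)], because few copies pass through a given pair.

    If [M] fits [G], its support misses [Q'].  Among the principal submatrices
    of [M], take one of size [n'] and rank [k'] with [k' / n'] minimal.  By
    minimality, every set of rows [A] has rank at least [#|A| * k' / n'], so
    greedy row and column bases have at most [u = s k' / n'] nonzero entries,
    where [s] is the size of the support.  The submatrix is a rational function
    of these entries, whence at most [n ^ O(u)] possible supports by the bound
    on the number of zero patterns of polynomials.  A union bound excludes all
    of them as soon as [k' / n'] is below a small multiple of [q / log n]. *)

Require Import Defs.
From HB Require Import structures.
From Stdlib Require Import Reals Lra ClassicalEpsilon.
From mathcomp Require Import Rstruct.
From mathcomp Require Import all_boot all_order all_algebra.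
From mathcomp Require Import mpoly zify boolp.

Set Implicit Arguments.
Unset Strict Implicit.
Unset Printing Implicit Defensive.

Import Order.TTheory GRing.Theory Num.Theory.

(** * Random subsets and deletion of a maximal disjoint family *)

Section RandomDeletion.
Local Open Scope ring_scope.

(** The probability of the outcome [Q] when each element of [E] is kept independently with
    probability [q]; events are measured by finite sums of these weights. *)
Definition bernoulli_weight (K : pzRingType) (E : finType) (q : K) (Q : {set E}) : K :=
  \prod_x (if x \in Q then q else 1 - q).

(** The event forces [A] into [Q] and [S :\: A] out of it and leaves the other elements free, so the
    sum factors over the elements of [E]. *)
Lemma bernoulli_weight_cylinder (K : comNzRingType) (E : finType) (q : K)
    (A S : {set E}) :
  \sum_(Q : {set E} | (A \subset Q) && (Q :&: S \subset A)) bernoulli_weight q Q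
  = q ^+ #|A| * (1 - q) ^+ #|S :\: A|.
Proof.
pose F x := if x \in A then q else if x \in S then 0 else q.
pose G x := if x \in A then 0 else 1 - q.
transitivity (\prod_x (F x + G x)); last first.
  rewrite (bigID (mem A)) /=; congr (_ * _).
    by rewrite -prodr_const; apply: eq_bigr => x xA; rewrite /F /G xA addr0.
  rewrite (bigID (mem S)) /= [X in _ * X]big1 ?mulr1; last first.
    by move=> x /andP[/negPf xA /negPf xS]; rewrite /F /G xA xS addrC subrK.
  rewrite -prodr_const; apply: eq_big => [x|x]; first by rewrite inE.
  by case/andP=> /negPf xA xS; rewrite /F /G xA xS add0r.
rewrite bigA_distr /=.
rewrite [RHS](bigID (fun Q : {set E} => (A \subset Q) && (Q :&: S \subset A))) /=.
rewrite [X in _ = _ + X]big1 ?addr0.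
  apply: eq_bigr => Q /andP[sAQ sQA]; apply: eq_bigr => x _; rewrite /F /G.
  case: ifP => xQ; case: ifP => xA //; last by rewrite (subsetP sAQ) in xQ.
  case: ifP => // xS; have : x \in Q :&: S by rewrite inE xQ xS.
  by move/(subsetP sQA); rewrite xA.
move=> Q; rewrite negb_and => /orP[] /subsetPn[x].
  by move=> xA xQ; rewrite (bigD1 x) //= /G (negPf xQ) xA mul0r.
rewrite inE => /andP[xQ xS] xA.
by rewrite (bigD1 x) //= /F (negPf xA) xQ xS mul0r.
Qed.

Lemma sum_bernoulli_weight (K : comNzRingType) (E : finType) (q : K) :
  \sum_(Q : {set E}) bernoulli_weight q Q = 1.
Proof.
transitivity (q ^+ #|set0 : {set E}| * (1 - q) ^+ #|(set0 : {set E}) :\: set0|).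
  rewrite -bernoulli_weight_cylinder; apply: eq_bigl => Q.
  by rewrite sub0set setI0 sub0set.
by rewrite setD0 cards0 !expr0 mulr1.
Qed.

Lemma sum_subset_exp (K : comNzRingType) (E : finType) (x : K) (A : {set E}) :
  \sum_(B : {set E} | B \subset A) x ^+ #|B| = (1 + x) ^+ #|A|.
Proof.
pose F y := if y \in A then x else 0.
transitivity (\prod_y (F y + 1)); last first.
  rewrite (bigID (mem A)) /= [X in _ * X]big1 ?mulr1; last first.
    by move=> y /negPf yA; rewrite /F yA add0r.
  by rewrite -prodr_const; apply: eq_bigr => y yA; rewrite /F yA addrC.
rewrite bigA_distr /= [RHS](bigID (fun B : {set E} => B \subset A)) /=.
rewrite [X in _ = _ + X]big1 ?addr0.
  apply: eq_bigr => B sBA; rewrite (bigID (mem B)) /= [X in _ * X]big1 ?mulr1.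
    by rewrite -prodr_const; apply: eq_bigr => y yB; rewrite /F yB (subsetP sBA).
  by move=> y /negPf ->.
move=> B /subsetPn[y yB yA].
by rewrite (bigD1 y) //= yB /F (negPf yA) mul0r.
Qed.

Lemma union_bound (K : numDomainType) (I J : finType) (b : pred I) (r : pred J)
    (c : J -> pred I) (w : I -> K) :
  (forall i, 0 <= w i) -> (forall i, b i -> exists2 j, r j & c j i) ->
  \sum_(i | b i) w i <= \sum_(j | r j) \sum_(i | c j i) w i.
Proof.
move=> w0 bc; rewrite (exchange_big_dep predT) //= big_mkcond /=.
apply: ler_sum => i _; case: ifP => [/bc[j rj cji]|_]; last exact: sumr_ge0.
by rewrite (bigD1 j) ?rj //= lerDl sumr_ge0.
Qed.

(* Delete from a [q]-random set [Q] the union of a maximal disjoint family of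
   members of [C] inside [Q].  If the rest misses [S], the members of the
   family meeting [S] cover [Q :&: S], and summing over the possible families
   turns the failure probability into the binomial expression below. *)
Lemma hitting_set_avoiding (K : realFieldType) (E J : finType)
    (C : {set {set E}}) (P : pred J) (sigma : J -> {set E}) (f D : nat) (q : K) :
  0 < q -> q < 1 -> (0 < f)%N ->
  (forall X, X \in C -> #|X| = f) ->
  (forall j x, P j -> x \in sigma j -> (#|[set X in C | x \in X]| <= D)%N) ->
  \sum_(j | P j) ((1 - q) * (1 + (q / (1 - q)) ^+ f) ^+ D) ^+ #|sigma j| < 1 ->
  exists Q : {set E}, (forall X, X \in C -> ~~ (X \subset Q)) /\
    (forall j, P j -> exists2 x, x \in Q & x \in sigma j).
Proof.
move=> q0 q1 f0 Cf CD sum1.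
have p0 : 0 < 1 - q by rewrite subr_gt0.
have w0 (Q : {set E}) : 0 <= bernoulli_weight q Q.
  by apply: prodr_ge0 => x _; case: ifP => _; exact: ltW.
pose packing (Q : {set E}) (F : {set {set E}}) :=
  [&& F \subset C, trivIset F & cover F \subset Q].
have fam_ex Q : {F | maxset (packing Q) F}.
  have [|F mF _] := @maxset_exists _ (packing Q) set0; last by exists F.
  rewrite /packing sub0set /cover big_set0 sub0set andbT /=.
  by apply/trivIsetP => A B; rewrite inE.
pose fam Q := sval (fam_ex Q).
have famP Q : maxset (packing Q) (fam Q) by exact: (svalP (fam_ex Q)).
pose clean Q := Q :\: cover (fam Q).
have clean_free Q X : X \in C -> ~~ (X \subset clean Q).
  move=> XC; apply/negP => sX.
  have [/and3P[FC tF cF] maxF] := maxsetP (famP Q).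
  have X0 : X != set0 by rewrite -card_gt0 Cf.
  have disj A : A \in fam Q -> [disjoint X & A].
    move=> AF; apply/pred0P => x /=; apply/negbTE/negP => /andP[xX xA].
    have := subsetP sX x xX; rewrite inE => /andP[/negP + _]; apply.
    by apply/bigcupP; exists A.
  have XF : X \notin fam Q.
    apply/negP => /disj; rewrite -setI_eq0 setIid => /eqP X00.
    by rewrite X00 eqxx in X0.
  have /eqP : X |: fam Q = fam Q.
    apply: maxF; last exact: subsetUr.
    apply/and3P; split.
    - by rewrite subUset sub1set XC.
    - apply/trivIsetP => A B; rewrite !inE.
      have trF := trivIsetP tF.
      case/orP => [/eqP->|AF] /orP[/eqP->|BF] AB.
      + by rewrite eqxx in AB.
      + exact: disj.
      + by rewrite disjoint_sym; exact: disj.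
      + exact: trF.
    - rewrite /cover bigcup_setU big_set1 subUset cF andbT.
      by apply: subset_trans sX _; exact: subsetDl.
  by move/eqP/setP/(_ X); rewrite !inE eqxx (negPf XF).
pose bad j Q := [disjoint clean Q & sigma j].
have badle j : P j -> \sum_(Q | bad j Q) bernoulli_weight q Q <=
    ((1 - q) * (1 + (q / (1 - q)) ^+ f) ^+ D) ^+ #|sigma j|.
  move=> Pj; set S := sigma j.
  pose CS := [set X in C | ~~ [disjoint X & S]].
  (* If nothing of [S] survives the deletion, every element of [Q :&: S] lies in a member of [fam Q]
     meeting [S]; [F] is the subfamily of these members. *)
  have le1 := @union_bound K {set E} {set {set E}} (bad j)
    (fun F => (F \subset CS) && trivIset F)
    (fun F Q => (cover F \subset Q) && (Q :&: S \subset cover F))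
    (@bernoulli_weight K E q) w0.
  apply: (le_trans (le1 _)) => {le1}.
    move=> Q badQ; have [/and3P[FC tF cF] _] := maxsetP (famP Q).
    exists [set X in fam Q | ~~ [disjoint X & S]].
      apply/andP; split.
        by apply/subsetP => X; rewrite !inE => /andP[/(subsetP FC) -> ->].
      by apply: trivIsetS tF; apply/subsetP => X; rewrite inE => /andP[].
    apply/andP; split.
      apply: subset_trans cF; apply/subsetP => x /bigcupP[X].
      by rewrite inE => /andP[XF _] xX; apply/bigcupP; exists X.
    apply/subsetP => x; rewrite inE => /andP[xQ xS].
    have xclean : x \notin clean Q.
      by apply/negP => xc; have /pred0P/(_ x) := badQ; rewrite /= xc xS.
    move: xclean; rewrite inE xQ andbT negbK => /bigcupP[X XF xX].
    apply/bigcupP; exists X => //; rewrite inE XF /=.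
    by apply/pred0Pn; exists x; rewrite /= xX.
  have le2 (F : {set {set E}}) : (F \subset CS) && trivIset F ->
     \sum_(Q : {set E} | (cover F \subset Q) && (Q :&: S \subset cover F)) bernoulli_weight q Q
     <= (1 - q) ^+ #|S| * ((q / (1 - q)) ^+ f) ^+ #|F|.
    case/andP=> sF /eqP tF; rewrite bernoulli_weight_cylinder.
    have cardF : #|cover F| = (f * #|F|)%N.
      rewrite -tF mulnC -sum_nat_const; apply: eq_bigr => X XF.
      by apply: Cf; have := subsetP sF X XF; rewrite inE => /andP[].
    (* Besides the [f * #|F|] elements of [cover F] forced into [Q], at least [#|S| - #|cover F|]
       elements of [S] are forced out. *)
    rewrite -exprM -cardF exprMn mulrCA ler_pM2l ?exprn_gt0 // exprVn.
    rewrite ler_pdivlMr ?exprn_gt0 // -exprD.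
    apply: ler_wiXn2l; rewrite ?(ltW p0) ?gerBl ?(ltW q0) //.
    by rewrite addnC -(cardsID (cover F) S) leq_add2r subset_leq_card ?subsetIr.
  have cardCS : (#|CS| <= D * #|S|)%N.
    rewrite -sum1_card.
    apply: (@leq_trans (\sum_(X in CS) \sum_(x in S) (x \in X))).
      apply: leq_sum => X; rewrite inE => /andP[_ /pred0Pn[x /andP[/= xX xS]]].
      by rewrite (bigD1 x xS) /= (xX : x \in X).
    rewrite exchange_big /= mulnC -sum_nat_const leq_sum // => x xS.
    apply: leq_trans (CD j x Pj xS); rewrite -sum1dep_card big_mkcond /=.
    rewrite [X in (_ <= X)%N]big_mkcond /=; apply: leq_sum => X _.
    by rewrite inE; case: (X \in C) => //=; case: ifP => //; case: (x \in X).
  apply: (le_trans (ler_sum _ le2)).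
  (* Forgetting disjointness, the sum over all subfamilies of [CS] is evaluated by the binomial
     theorem. *)
  apply: (@le_trans _ _ (\sum_(F : {set {set E}} | F \subset CS)
      (1 - q) ^+ #|S| * ((q / (1 - q)) ^+ f) ^+ #|F|)).
    rewrite big_mkcond [leRHS]big_mkcond /=; apply: ler_sum => F _.
    case: (F \subset CS) => //=; case: ifP => // _.
    by rewrite mulr_ge0 ?exprn_ge0 ?divr_ge0 ?ltW.
  rewrite -mulr_sumr sum_subset_exp [leRHS]exprMn ler_pM2l ?exprn_gt0 // -[leRHS]exprM.
  by apply: ler_weXn2l => //; rewrite lerDl exprn_ge0 ?divr_ge0 ?ltW.
pose allbad := [pred Q | [exists j, P j && bad j Q]].
have /existsP[Q] : [exists Q, ~~ allbad Q].
  rewrite -negb_forall; apply/negP => /forallP all_bad.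
  suff : (1 : K) < 1 by rewrite ltxx.
  apply: le_lt_trans sum1; rewrite -{1}(sum_bernoulli_weight E q).
  rewrite (eq_bigl allbad) => [|Q]; last by rewrite all_bad.
  apply: le_trans (ler_sum _ badle); apply: union_bound => // Q.
  by case/existsP => j /andP[Pj bj]; exists j.
rewrite negb_exists => /forallP nb; exists (clean Q); split=> [X|j Pj].
  exact: clean_free.
have := nb j; rewrite Pj /= => /pred0Pn[x /andP[xc xs]].
by exists x.
Qed.
End RandomDeletion.

(** * Counting zero patterns of polynomials *)

Section ZeroPatterns.
Local Open Scope ring_scope.
Variable F : fieldType.

Definition mdegree_le (N d : nat) (p : {mpoly F[N]}) : bool := (msize p <= d.+1)%N.

Lemma mdegree_leC N d (c : F) : mdegree_le d (c%:MP_[N]).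
Proof. by rewrite /mdegree_le msizeC (leq_trans (leq_b1 _)). Qed.

Lemma mdegree_leM N a b (p q : {mpoly F[N]}) :
  mdegree_le a p -> mdegree_le b q -> mdegree_le (a + b) (p * q).
Proof.
rewrite /mdegree_le => pa qb.
have [->|p0] := eqVneq p 0; first by rewrite mul0r msize0.
have [->|q0] := eqVneq q 0; first by rewrite mulr0 msize0.
rewrite msizeM // -subn1 leq_subLR add1n.
by rewrite (leq_trans (leq_add pa qb)) // addSn addnS.
Qed.

Lemma mdegree_le_sum N d (I : finType) (P : pred I) (p : I -> {mpoly F[N]}) :
  (forall i, P i -> mdegree_le d (p i)) -> mdegree_le d (\sum_(i | P i) p i).
Proof. by move=> pd; apply: leq_trans (msize_sum _ _ _) _; apply/bigmax_leqP. Qed.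

Lemma mdegree_le_prod N d (I : finType) (P : pred I) (p : I -> {mpoly F[N]}) :
  (forall i, P i -> mdegree_le d (p i)) ->
  mdegree_le (\sum_(i | P i) d) (\prod_(i | P i) p i).
Proof.
move=> pd; apply: (big_rec2 (fun a q => mdegree_le a q)).
  by rewrite -mpolyC1; exact: mdegree_leC.
by move=> i a q Pi aq; apply: mdegree_leM; rewrite ?pd.
Qed.

Lemma mdegree_leW N a b (p : {mpoly F[N]}) :
  (a <= b)%N -> mdegree_le a p -> mdegree_le b p.
Proof. by rewrite /mdegree_le => ab pa; apply: leq_trans pa _. Qed.

(** Each exponent is at most the total degree, which embeds these monomials into the functions from
    [N] variables to [d.+1] values. *)
Lemma card_bmultinom_le (N d : nat) : (#|{: 'X_{1.. N < d.+1}}| <= d.+1 ^ N)%N.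
Proof.
pose h (m : 'X_{1.. N < d.+1}) := [ffun i => inord (bmnm m i) : 'I_d.+1].
have hinj : injective h.
  move=> m1 m2 /ffunP eqh; apply/val_inj/mnmP => i.
  have bnd (m : 'X_{1.. N < d.+1}) : (bmnm m i < d.+1)%N.
    apply: leq_ltn_trans (bmdeg m); rewrite mdegE (bigD1 i) //=; exact: leq_addr.
  by have := eqh i; rewrite !ffunE => /(congr1 val); rewrite /= !inordK.
by rewrite -[X in (_ <= X ^ _)%N](card_ord d.+1) -[X in (_ <= _ ^ X)%N](card_ord N)
  -card_ffun (leq_card h).
Qed.

(* Ronyai-Babai-Ganapathy: if [v S] realizes the pattern [S], the product
   [g S] of the polynomials in [S] is nonzero at [v S'] iff [S \subset S'];
   this triangularity makes the [g S] linearly independent. *)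
Lemma card_zero_patterns (N d : nat) (J : finType) (p : J -> {mpoly F[N]})
    (X : {set {set J}}) :
  (forall j, mdegree_le d (p j)) ->
  (forall S, S \in X -> exists v : 'I_N -> F, S = [set j | (p j).@[v] != 0]) ->
  (#|X| <= (#|J| * d).+1 ^ N)%N.
Proof.
move=> pd realized; set D := (#|J| * d)%N.
have [v vP] : exists v : {set J} -> 'I_N -> F,
    forall S, S \in X -> S = [set j | (p j).@[v S] != 0].
  have ex S : exists v : 'I_N -> F, S \in X -> S = [set j | (p j).@[v] != 0].
    case: (boolP (S \in X)) => [/realized[v Sv]|_]; first by exists v.
    by exists (fun=> 0).
  by have [v vP] := fin_all_exists ex; exists v.
pose g (S : {set J}) := \prod_(j in S) p j.
have gD S : (msize (g S) <= D.+1)%N.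
  apply: mdegree_leW (mdegree_le_prod (fun j _ => pd j)).
  by rewrite sum_nat_const leq_mul2r max_card orbT.
have gv S S' : S' \in X -> ((g S).@[v S'] != 0) = (S \subset S').
  move=> S'X; rewrite rmorph_prod [in RHS](vP _ S'X).
  apply/prodf_neq0/subsetP => [h j jS|h j jS]; first by rewrite inE h.
  by have := h j jS; rewrite inE.
pose e i := enum_val (A := mem X) i.
pose A := \matrix_(i, j < #|X|) (g (e i)).@[v (e j)].
pose B := \matrix_(i < #|X|, k < #|{: 'X_{1.. N < D.+1}}|)
   (g (e i))@_(enum_val k).
pose W := \matrix_(k < #|{: 'X_{1.. N < D.+1}}|, j < #|X|)
   \prod_l v (e j) l ^+ (bmnm (enum_val k) l).
(* Expansion in monomials factors [A] through the polynomials of degree at most [D]; once [A] has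
   full row rank, [#|X|] is at most the number of monomials. *)
have AE : A = B *m W.
  apply/matrixP => i j; rewrite !mxE [in LHS](mpolywE (gD _)) raddf_sum /=.
  rewrite (reindex_onto (@enum_val _ {: 'X_{1.. N < D.+1}}) enum_rank) /=; last first.
    by move=> m _; rewrite enum_rankK.
  rewrite (eq_bigl predT) => [|k]; last by rewrite enum_valK eqxx.
  by apply: eq_bigr => k _; rewrite !mxE mevalZ mevalX.
have Afree : row_free A.
  apply: inj_row_free => x xA; apply/eqP/negPn/negP => x0.
  have [i0 xi0] : exists i, x 0 i != 0.
    apply/existsP; apply: contraNT x0; rewrite negb_exists => /forallP h.
    by apply/eqP/rowP => i; rewrite mxE; have := h i; rewrite negbK => /eqP.
  (* In a dependency take a pattern [e i] of least size: in column [i] every other term vanishes,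
     since [e k \subset e i] and [#|e i| <= #|e k|] force equality. *)
  pose i := [arg min_(i < i0 | x 0 i != 0) #|e i|].
  have [xi imin] : x 0 i != 0 /\ forall j, x 0 j != 0 -> (#|e i| <= #|e j|)%N.
    by rewrite /i; case: arg_minnP.
  have := congr1 (fun M : 'rV_#|X| => M 0 i) xA; rewrite !mxE (bigD1 i) //=.
  rewrite big1 ?addr0 => [/eqP|k ki].
    rewrite mulf_eq0 (negPf xi) mxE /=; apply/negP; rewrite gv //.
    exact: enum_valP.
  rewrite mxE; have [->|xk] := eqVneq (x 0 k) 0; first by rewrite mul0r.
  have [->|] := eqVneq (g (e k)).@[v (e i)] 0; first by rewrite mulr0.
  rewrite gv ?enum_valP // => ski; case/eqP: ki; apply: enum_val_inj.
  by apply/eqP; rewrite eqEcard ski imin.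
apply: leq_trans (card_bmultinom_le N D).
by rewrite -(eqP Afree) AE (leq_trans (mxrankM_maxr _ _)) // rank_leq_row.
Qed.

End ZeroPatterns.

(** * Row bases of small weight *)

Section SparseBases.
Local Open Scope ring_scope.
Variable F : fieldType.

(** Rows outside [A] are zeroed, not removed, so the type does not depend on [A]. The rows in [A]
    are independent exactly when the rank equals [#|A|]. *)
Definition row_mask m n (A : {set 'I_m}) (M : 'M[F]_(m, n)) : 'M[F]_(m, n) :=
  \matrix_(i, j) (if i \in A then M i j else 0).

Lemma row_row_mask m n (A : {set 'I_m}) (M : 'M[F]_(m, n)) i :
  row i (row_mask A M) = if i \in A then row i M else 0.
Proof. by apply/rowP => j; rewrite !mxE; case: ifP => _; rewrite !mxE. Qed.

Lemma row_mask_subP m n p (A : {set 'I_m}) (M : 'M[F]_(m, n)) (N : 'M[F]_(p, n)) :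
  reflect (forall i, i \in A -> (row i M <= N)%MS) (row_mask A M <= N)%MS.
Proof.
apply: (iffP row_subP) => h i => [iA|].
  by have := h i; rewrite row_row_mask iA.
by rewrite row_row_mask; case: ifP => [/h|_] //; exact: sub0mx.
Qed.

Lemma row_sub_row_mask m n (A : {set 'I_m}) (M : 'M[F]_(m, n)) i :
  i \in A -> (row i M <= row_mask A M)%MS.
Proof. by move=> iA; have /row_mask_subP := submx_refl (row_mask A M); apply. Qed.

Lemma row_maskS m n (A B : {set 'I_m}) (M : 'M[F]_(m, n)) :
  A \subset B -> (row_mask A M <= row_mask B M)%MS.
Proof.
by move=> sAB; apply/row_mask_subP => i iA; rewrite row_sub_row_mask // (subsetP sAB).
Qed.

Lemma rank_row_mask_le_card m n (A : {set 'I_m}) (M : 'M[F]_(m, n)) :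
  (\rank (row_mask A M) <= #|A|)%N.
Proof.
apply: leq_trans (rank_leq_row (rowsub (enum_val (A := mem A)) M)).
apply: mxrankS; apply/row_mask_subP => i iA.
by rewrite -(enum_rankK_in iA iA) -row_rowsub row_sub.
Qed.

(** A maximal independent set of rows between [B] and [A] spans all rows in [A], since a row outside
    its span could be added. *)
Lemma extend_row_basis m n (M : 'M[F]_(m, n)) (A B : {set 'I_m}) :
  B \subset A -> \rank (row_mask B M) = #|B| ->
  exists B' : {set 'I_m}, [/\ B \subset B', B' \subset A, \rank (row_mask B' M) = #|B'|
                & #|B'| = \rank (row_mask A M)].
Proof.
move=> sBA rB.
pose P (C : {set 'I_m}) := (C \subset A) && (\rank (row_mask C M) == #|C|).
have [|B' /maxsetP[/andP[sB'A /eqP rB'] maxB'] sBB'] := @maxset_exists _ P B.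
  by rewrite /P sBA rB eqxx.
exists B'; split=> //; rewrite -rB'; apply/eqP; rewrite eqn_leq mxrankS ?row_maskS //=.
apply: mxrankS; apply/row_mask_subP => i iA; apply/negPn/negP => niB'.
have iB' : i \notin B' by apply: contra niB'; exact: row_sub_row_mask.
have : i |: B' = B'.
  apply: maxB'; last exact: subsetUr.
  rewrite /P subUset sub1set iA sB'A /= eqn_leq rank_row_mask_le_card /=.
  rewrite cardsU1 iB' -rB' add1n; apply: rank_ltmx.
  rewrite ltmxE row_maskS ?subsetUr //=.
  apply: contra niB'; apply: submx_trans.
  by apply: row_sub_row_mask; rewrite !inE eqxx.
by move/setP/(_ i); rewrite !inE eqxx (negPf iB').
Qed.

(** [w i] counts the thresholds [t < T] below it; the two summations are exchanged. *)
Lemma layer_cake (I : finType) (A : {set I}) (w : I -> nat) (T : nat) :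
  (forall i, (w i <= T)%N) ->
  (\sum_(i in A) w i = \sum_(t < T) #|[set i in A | t < w i]|)%N.
Proof.
move=> wT; under [RHS]eq_bigr => t _ do rewrite -sum1dep_card big_mkcondr /=.
rewrite exchange_big /=; apply: eq_bigr => i _.
rewrite -big_mkcond /= -(big_ord_widen T (fun=> 1%N) (wT i)) /=.
by rewrite sum1_card card_ord.
Qed.

(* The greedy basis contains at least [\rank (row_mask A M)] of the elements
   of each sublevel set [A] of the weight [w]; summing over the levels
   compares its weight with the average weight. *)
Lemma sparse_row_basis m n (M : 'M[F]_(m, n)) (I : {set 'I_m}) (w : 'I_m -> nat) :
  (forall A : {set 'I_m}, A \subset I ->
     (\rank (row_mask I M) * #|A| <= \rank (row_mask A M) * #|I|)%N) ->
  exists B : {set 'I_m}, [/\ B \subset I, \rank (row_mask B M) = #|B|,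
     #|B| = \rank (row_mask I M)
   & ((\sum_(i in B) w i) * #|I| <= \rank (row_mask I M) * \sum_(i in I) w i)%N].
Proof.
move=> dense; set k := \rank (row_mask I M) in dense *.
pose T := \max_i w i.
have wT i : (w i <= T)%N by apply: leq_bigmax.
pose L t := [set i in I | (w i <= t)%N].
have [B [sBL rB BL]] : exists B : {set 'I_m}, [/\ B \subset L T, \rank (row_mask B M) = #|B|
    & forall s, (s <= T)%N -> (\rank (row_mask (L s) M) <= #|B :&: L s|)%N].
  (* The greedy choice: a basis of each sublevel set [L t] is extended to one of [L t.+1], which
     keeps the counts at lower levels. *)
  elim: T {wT} => [|t [B [sBL rB BL]]].
    have [|B [_ sB rB cB]] := @extend_row_basis m n M (L 0%N) set0 (sub0set _).
      by apply/eqP; rewrite cards0 -leqn0 -(cards0 'I_m) rank_row_mask_le_card.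
    by exists B; split=> // s; rewrite leqn0 => /eqP->; rewrite (setIidPl sB) cB.
  have sL : L t \subset L t.+1.
    by apply/subsetP => i; rewrite !inE => /andP[-> /= h]; exact: leqW.
  have [B' [sBB' sB' rB' cB']] := extend_row_basis (subset_trans sBL sL) rB.
  exists B'; split=> // s; rewrite leq_eqVlt => /orP[/eqP->|].
    by rewrite (setIidPl sB') cB'.
  by rewrite ltnS => /BL h; apply: leq_trans h _; rewrite subset_leq_card ?setSI.
have LT : L T = I by apply/setP => i; rewrite inE wT andbT.
rewrite LT in sBL.
have cB : #|B| = k.
  apply/eqP; rewrite eqn_leq -rB mxrankS ?row_maskS //= rB.
  by have := BL T (leqnn _); rewrite LT (setIidPl sBL).
exists B; split=> //.
rewrite !(layer_cake _ wT) big_distrl big_distrr /=; apply: leq_sum => t _.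
have split_card (A : {set 'I_m}) : A \subset I ->
    #|[set i in A | (t < w i)%N]| = (#|A| - #|A :&: L t|)%N.
  move=> sAI; rewrite -cardsDS ?subsetIl //; apply: eq_card => i.
  rewrite !inE ltnNge; case: (boolP (i \in A)) => //= iA.
  by rewrite (subsetP sAI _ iA) /= andbT.
(* At level [t] the claim becomes [k * #|L t| <= #|B :&: L t| * #|I|], which follows from [dense] at
   [L t] and the greedy property [BL]. *)
rewrite !split_card // cB mulnBl mulnBr leq_sub2l //.
rewrite (setIidPr _); last by apply/subsetP => i; rewrite inE => /andP[].
apply: leq_trans (dense (L t) _) _.
  by apply/subsetP => i; rewrite inE => /andP[].
by rewrite leq_mul2r BL ?orbT // ltnW.
Qed.

End SparseBases.

(** * Supports of matrices with sparse row and column bases *)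

Section SupportPatterns.
Local Open Scope ring_scope.
Variable F : fieldType.

Definition mxsupp m n (A : 'M[F]_(m, n)) : {set 'I_m * 'I_n} :=
  [set x | A x.1 x.2 != 0].

(** The list of positions is padded to length [u] by [x0] with coefficient zero, so that supports of
    different sizes share one format. *)
Lemma sparse_mx_decomposition m n u (A : 'M[F]_(m, n)) (x0 : 'I_m * 'I_n) :
  (#|mxsupp A| <= u)%N ->
  exists (pos : {ffun 'I_u -> 'I_m * 'I_n}) (v : 'I_u -> F),
    A = \sum_l v l *: delta_mx (pos l).1 (pos l).2.
Proof.
move=> su; pose s := enum (mxsupp A).
have sE : size s = #|mxsupp A| by rewrite -cardE.
exists [ffun l : 'I_u => nth x0 s l].
exists (fun l : 'I_u => if (l < size s)%N then A (nth x0 s l).1 (nth x0 s l).2 else 0).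
transitivity (\sum_(x in mxsupp A) A x.1 x.2 *: delta_mx x.1 x.2).
  rewrite [LHS]matrix_sum_delta pair_big /= [LHS](bigID (mem (mxsupp A))) /=.
  rewrite [X in _ + X]big1 ?addr0 // => x; rewrite inE negbK => /eqP->.
  by rewrite scale0r.
rewrite -big_enum (big_nth x0) big_mkord -/s.
rewrite -sE in su.
rewrite (big_ord_widen u (fun l => A (nth x0 s l).1 (nth x0 s l).2 *:
  delta_mx (nth x0 s l).1 (nth x0 s l).2) su) big_mkcond /=.
by apply: eq_bigr => l _; rewrite !ffunE; case: ifP; rewrite ?scale0r.
Qed.

(** This is [M = C P^-1 R] for a row basis [R], a column basis [C] and their intersection [P]. The
    adjugate replaces the inverse to keep the entries polynomial; the nonzero factor [\det P] leaves
    the support unchanged. *)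
Lemma mx_skeleton_decomposition n k (M : 'M[F]_n) (f g : 'I_k -> 'I_n) :
  \rank M = k -> \rank (rowsub f M) = k -> \rank (colsub g M) = k ->
  \det (mxsub f g M) != 0 /\
  \det (mxsub f g M) *: M = colsub g M *m \adj (mxsub f g M) *m rowsub f M.
Proof.
move=> rM rR rC; set P := mxsub f g M.
have /submxP[A AE] : (M <= rowsub f M)%MS.
  by rewrite -(mxrank_leqif_sup (rowsub_sub f M)) rR rM.
have CE : colsub g M = A *m P.
  by rewrite {1}AE mxsub_mul /= /P mxsubcr; congr (_ *m _); apply/matrixP => i j; rewrite !mxE.
(* The column basis [A *m P] has rank [k], hence so does the square matrix [P]. *)
have Punit : P \in unitmx.
  by rewrite -row_full_unit /row_full eqn_leq rank_leq_col -{1}rC CE mxrankM_maxr.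
split; first by rewrite -unitfE -unitmxE.
by rewrite CE -(mulmxA A) mul_mx_adj -mulmxA mul_scalar_mx -scalemxAr -AE.
Qed.

Section GenericMatrix.
Variables (n k u : nat) (f g : 'I_k -> 'I_n).
Variables (posR : 'I_u -> 'I_k * 'I_n) (posC : 'I_u -> 'I_n * 'I_k).

(** One variable per prescribed position: the left half of the [u + u] variables fills the rows, the
    right half the columns. *)
Definition generic_rows : 'M[{mpoly F[u + u]}]_(k, n) :=
  \sum_l 'X_(lshift u l) *: delta_mx (posR l).1 (posR l).2.

Definition generic_cols : 'M[{mpoly F[u + u]}]_(n, k) :=
  \sum_l 'X_(rshift u l) *: delta_mx (posC l).1 (posC l).2.

(** The generic form of [\det P *: M]; the block [P] is read off the generic rows. *)
Definition generic_mx : 'M[{mpoly F[u + u]}]_n :=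
  generic_cols *m \adj (colsub g generic_rows) *m generic_rows.

Lemma mdegree_le_generic_rows i j : mdegree_le 1 (generic_rows i j).
Proof.
rewrite summxE; apply: mdegree_le_sum => l _; rewrite !mxE -[1%N]addn0.
apply: mdegree_leM; first by rewrite /mdegree_le msizeX mdeg1.
by rewrite -mpolyC_nat; exact: mdegree_leC.
Qed.

Lemma mdegree_le_generic_cols i j : mdegree_le 1 (generic_cols i j).
Proof.
rewrite summxE; apply: mdegree_le_sum => l _; rewrite !mxE -[1%N]addn0.
apply: mdegree_leM; first by rewrite /mdegree_le msizeX mdeg1.
by rewrite -mpolyC_nat; exact: mdegree_leC.
Qed.

Lemma mdegree_le_sign N (b : nat) : mdegree_le 0 ((-1) ^+ b : {mpoly F[N]}).
Proof.
by rewrite -mpolyC1 -mpolyCN -rmorphXn /=; exact: mdegree_leC.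
Qed.

Lemma mdegree_le_det N m (A : 'M[{mpoly F[N]}]_m) :
  (forall i j, mdegree_le 1 (A i j)) -> mdegree_le m (\det A).
Proof.
move=> A1; apply: mdegree_le_sum => s _.
apply: (@mdegree_leM F N 0); first exact: mdegree_le_sign.
apply: (@mdegree_leW F N (\sum_(i < m) 1)); first by rewrite sum1_card card_ord.
exact: mdegree_le_prod.
Qed.

(** A cofactor is a signed determinant of size [k.-1], of degree at most [k]; each outer factor adds
    one. *)
Lemma mdegree_le_generic_mx i j : mdegree_le k.+2 (generic_mx i j).
Proof.
rewrite mxE; apply: mdegree_le_sum => a _; rewrite -addn1.
apply: mdegree_leM (mdegree_le_generic_rows a j).
rewrite mxE; apply: mdegree_le_sum => b _; rewrite -add1n.
apply: mdegree_leM (mdegree_le_generic_cols i b) _.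
rewrite mxE; apply: (@mdegree_leM F _ 0); first exact: mdegree_le_sign.
apply: (@mdegree_leW F _ k.-1); first exact: leq_pred.
apply: mdegree_le_det => c d; rewrite !mxE; exact: mdegree_le_generic_rows.
Qed.

Lemma generic_mx_eval (M : 'M[F]_n) (vR vC : 'I_u -> F) :
  rowsub f M = \sum_l vR l *: delta_mx (posR l).1 (posR l).2 ->
  colsub g M = \sum_l vC l *: delta_mx (posC l).1 (posC l).2 ->
  map_mx (meval (fun i => match split i with inl l => vR l | inr l => vC l end))
    generic_mx = colsub g M *m \adj (mxsub f g M) *m rowsub f M.
Proof.
move=> RE CE; set v := (X in meval X).
have ER : map_mx (meval v) generic_rows = rowsub f M.
  rewrite RE raddf_sum; apply: eq_bigr => l _ /=.
  rewrite map_mxZ /= map_delta_mx mevalXU /v; congr (_ *: _).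
  case: split_ordP => l' /(congr1 val) /= h; first by congr vR; apply: val_inj.
  by have := ltn_ord l; rewrite h ltnNge leq_addr.
have EC : map_mx (meval v) generic_cols = colsub g M.
  rewrite CE raddf_sum; apply: eq_bigr => l _ /=.
  rewrite map_mxZ /= map_delta_mx mevalXU /v; congr (_ *: _).
  case: split_ordP => l' /(congr1 val) /= h; last first.
    by congr vC; apply: val_inj; apply: (@addnI u).
  by have := ltn_ord l'; rewrite -h ltnNge leq_addr.
by rewrite !map_mxM /= map_mx_adj map_mxsub ER EC -mxsubcr.
Qed.

End GenericMatrix.

(** [f] and [g] pick a row and a column basis of a witness [M]. These determine [M], which makes
    such supports few even over an infinite field. *)
Definition sparsely_spanned n k u (S : {set 'I_n * 'I_n}) : Prop :=
  exists (M : 'M[F]_n) (f g : 'I_k -> 'I_n),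
  [/\ S = mxsupp M, \rank M = k, \rank (rowsub f M) = k, \rank (colsub g M) = k
    & (#|mxsupp (rowsub f M)| <= u)%N /\ (#|mxsupp (colsub g M)| <= u)%N].

(** The indices of the bases allow [n ^ (2 * u)] choices and the positions of their nonzero entries
    [n ^ (4 * u)]. Once these are fixed, the support is a zero pattern of [n * n] polynomials of
    degree at most [k.+2] in [u + u] variables, which leaves [n ^ (10 * u)]. *)
Lemma card_sparsely_spanned n k u (X : {set {set 'I_n * 'I_n}}) :
  (1 < n)%N -> (0 < k)%N -> (k <= u)%N -> (k <= n)%N ->
  (forall S, S \in X -> sparsely_spanned k u S) -> (#|X| <= n ^ (16 * u))%N.
Proof.
move=> n1 k0 ku kn XP; have n0 := ltnW n1.
have u0 : (0 < u)%N := leq_trans k0 ku.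
pose Data := (({ffun 'I_k -> 'I_n} * {ffun 'I_k -> 'I_n}) *
  ({ffun 'I_u -> 'I_k * 'I_n} * {ffun 'I_u -> 'I_n * 'I_k}))%type.
pose realizes (d : Data) (v : 'I_(u + u) -> F) (S : {set 'I_n * 'I_n}) :=
  S = [set x | (generic_mx d.1.2 d.2.1 d.2.2 x.1 x.2).@[v] != 0].
have [d dP] : exists d : {set 'I_n * 'I_n} -> Data,
    forall S, S \in X -> exists v, realizes (d S) v S.
  apply: (@fin_all_exists _ (fun=> Data)
     (fun S d => S \in X -> exists v, realizes d v S)) => S.
  case: (boolP (S \in X)) => [/XP|_]; last first.
    by exists ([ffun=> Ordinal n0], [ffun=> Ordinal n0],
      ([ffun=> (Ordinal k0, Ordinal n0)], [ffun=> (Ordinal n0, Ordinal k0)])).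
  case=> M [f [g [-> rM rR rC [sR sC]]]].
  have [pR [vR RE]] := sparse_mx_decomposition (Ordinal k0, Ordinal n0) sR.
  have [pC [vC CE]] := sparse_mx_decomposition (Ordinal n0, Ordinal k0) sC.
  exists ([ffun i => f i], [ffun i => g i], (pR, pC)) => _.
  have [P0 ME] := mx_skeleton_decomposition rM rR rC.
  exists (fun i => match split i with inl l => vR l | inr l => vC l end).
  apply/setP => x; rewrite !inE /=.
  have -> : generic_mx [ffun i => g i] pR pC = generic_mx g pR pC.
    by rewrite /generic_mx mxsub_ffunr.
  have := generic_mx_eval RE CE; rewrite -ME => /matrixP/(_ x.1 x.2).
  rewrite !mxE => ->; by rewrite mulf_eq0 (negPf P0).
have fiber (c : Data) : (#|[set S in X | d S == c]| <= n ^ (10 * u))%N.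
  apply: leq_trans (@card_zero_patterns F (u + u) k.+2 _
    (fun x : 'I_n * 'I_n => generic_mx c.1.2 c.2.1 c.2.2 x.1 x.2) _ _ _) _.
  - by move=> x; exact: mdegree_le_generic_mx.
  - by move=> S; rewrite inE => /andP[/dP[v rv] /eqP dc]; exists v; rewrite -dc.
  have -> : (10 * u = 5 * (u + u))%N by rewrite addnn -mul2n mulnA.
  rewrite expnM leq_exp2r ?addn_gt0 ?u0 // card_prod card_ord.
  (* What remains is [n * n * k.+2 + 1 <= n ^ 5], from [k <= n] and [2 <= n]. *)
  apply: (@leq_trans (n * n * n.+3)).
    rewrite (mulnS _ n.+2) -[X in (X < _)%N]add0n -addSn leq_add ?muln_gt0 ?n0 //.
    by rewrite leq_mul2l !ltnS kn orbT.
  have -> : (n ^ 5 = n * n * (n * n * n))%N by rewrite !expnS expn0 muln1 !mulnA.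
  rewrite leq_mul2l; apply/orP; right.
  apply: (@leq_trans (2 * 2 * n)); first by lia.
  by rewrite leq_mul2r leq_mul ?orbT.
rewrite -sum1_card (partition_big d predT) //=.
apply: (@leq_trans (\sum_(c : Data) n ^ (10 * u))).
  apply: leq_sum => c _; apply: leq_trans (fiber c).
  by rewrite -sum1_card; apply: eq_leq; apply: eq_bigl => S; rewrite !inE.
rewrite sum_nat_const !card_prod !card_ffun !card_prod !card_ord.
have -> : (16 * u = (u + u) + (2 * u + 2 * u) + 10 * u)%N by lia.
have kn2 : ((k * n) ^ u <= n ^ (2 * u))%N.
  by rewrite expnM leq_exp2r // expnS expn1 leq_mul2r kn orbT.
rewrite (expnD _ _ (10 * u)) leq_mul2r; apply/orP; right.
rewrite expnD leq_mul // expnD leq_mul ?leq_pexp2l // ?(mulnC n k) //.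
Qed.

End SupportPatterns.

(** * Principal submatrices of least ratio of rank to size *)

Section PrincipalPatterns.
Local Open Scope ring_scope.
Variable F : fieldType.

Definition principal_mask n (A : {set 'I_n}) (M : 'M[F]_n) : 'M[F]_n :=
  \matrix_(i, j) (if (i \in A) && (j \in A) then M i j else 0).

(** The support need not be symmetric: a pair is recorded as soon as one of its two positions is
    occupied. *)
Definition offdiag_pairs n (S : {set 'I_n * 'I_n}) : {set {set 'I_n}} :=
  [set [set x.1; x.2] | x in S & x.1 != x.2].

Lemma principal_maskT n (A : {set 'I_n}) (M : 'M[F]_n) :
  principal_mask A M^T = (principal_mask A M)^T.
Proof. by apply/matrixP => i j; rewrite !mxE andbC. Qed.

Lemma row_mask_principal_mask n (A : {set 'I_n}) (M : 'M[F]_n) :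
  row_mask A (principal_mask A M) = principal_mask A M.
Proof. by apply/matrixP => i j; rewrite !mxE; case: (i \in A). Qed.

(** Clearing the columns outside [A] is a right multiplication by a diagonal matrix, which cannot
    raise the rank. *)
Lemma rank_principal_mask_le n (A I : {set 'I_n}) (M : 'M[F]_n) : A \subset I ->
  (\rank (principal_mask A M) <= \rank (row_mask A (principal_mask I M)))%N.
Proof.
move=> sAI.
have -> : principal_mask A M =
    row_mask A (principal_mask I M) *m diag_mx (\row_j (j \in A)%:R).
  apply/matrixP => i j; rewrite mul_mx_diag !mxE.
  case: (boolP (i \in A)) => iA /=; last by rewrite mul0r.
  case: (boolP (j \in A)) => jA /=; last by rewrite mulr0.
  by rewrite !(subsetP sAI) // mulr1.
exact: mxrankM_maxl.
Qed.

Lemma rank_principal_mask_sub n (A I : {set 'I_n}) (M : 'M[F]_n) : A \subset I ->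
  (\rank (principal_mask A M) <= \rank (principal_mask I M))%N.
Proof.
move=> sAI; apply: leq_trans (rank_principal_mask_le M sAI) _.
by rewrite -[X in (_ <= \rank X)%N]row_mask_principal_mask mxrankS ?row_maskS.
Qed.

Lemma principal_maskTT n (M : 'M[F]_n) : principal_mask setT M = M.
Proof. by apply/matrixP => i j; rewrite !mxE !inE. Qed.

Lemma card_mxsupp m n (A : 'M[F]_(m, n)) :
  #|mxsupp A| = (\sum_i #|[set j | A i j != 0%R]|)%N.
Proof.
rewrite -sum1dep_card (eq_bigl (fun x => xpredT x.1 && (A x.1 x.2 != 0))) //.
rewrite -(pair_big_dep xpredT (fun i j => A i j != 0) (fun _ _ => 1%N)) /=.
by apply: eq_bigr => i _; rewrite sum1dep_card.
Qed.

Lemma card_mxsupp_tr m n (A : 'M[F]_(m, n)) : #|mxsupp A^T| = #|mxsupp A|.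
Proof.
rewrite -(card_imset _ (can_inj (@swap_pairK _ _))).
apply: eq_card => x; apply/imsetP/idP => [[y yA ->]|xA].
  by move: yA; rewrite !inE mxE.
by exists (x.2, x.1); [move: xA; rewrite !inE mxE | case: (x)].
Qed.

(** The rows in [J] are nonzero multiples of distinct unit vectors. *)
Lemma rank_diagonal_rows n (N : 'M[F]_n) (J : {set 'I_n}) :
  (forall i j, i \in J -> (N i j != 0) = (i == j)) -> (#|J| <= \rank N)%N.
Proof.
move=> NJ; have sub : (row_mask J 1%:M <= N)%MS.
  apply/row_mask_subP => i iJ.
  have -> : row i (1%:M : 'M[F]_n) = (N i i)^-1 *: row i N.
    apply/rowP => j; rewrite !mxE; have := NJ i j iJ.
    case: (eqVneq i j) => [<- Nii|_ /negbT]; first by rewrite mulVf.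
    by move/negbNE/eqP->; rewrite mulr0.
  by apply: scalemx_sub; exact: row_sub.
have sum1 : (1%:M : 'M[F]_n) = row_mask J 1%:M + row_mask (~: J) 1%:M.
  apply/matrixP => i j; rewrite !mxE inE.
  by case: (i \in J); rewrite ?addr0 ?add0r.
have := mxrank_add (row_mask J (1%:M : 'M[F]_n)) (row_mask (~: J) 1%:M).
rewrite -sum1 mxrank1 => le1.
have := leq_trans le1 (leq_add (mxrankS sub) (rank_row_mask_le_card _ _)).
by rewrite -{1}(card_ord n) -(cardsC J) leq_add2r.
Qed.

(** Only [(i, j)] and [(j, i)] give the same pair. *)
Lemma card_offdiag_pairs n (S : {set 'I_n * 'I_n}) :
  (#|[set x in S | x.1 != x.2]| <= 2 * #|offdiag_pairs S|)%N.
Proof.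
set D := [set x in S | x.1 != x.2].
have -> : offdiag_pairs S = [set [set x.1; x.2] | x in D].
  by apply/setP => p; apply/imsetP/imsetP => -[x xD ->]; exists x; rewrite // ?inE in xD *.
rewrite -sum1_card (partition_big_imset (fun x : 'I_n * 'I_n => [set x.1; x.2])) /=.
rewrite mulnC -sum_nat_const; apply: leq_sum => p.
case/imsetP => x xD ->.
apply: (@leq_trans #|[set x; (x.2, x.1)]|); last by rewrite cards2; case: eqP.
rewrite sum1dep_card subset_leq_card //; apply/subsetP => y.
rewrite !inE => /andP[_ /eqP eq_xy].
have y1 : y.1 \in [set x.1; x.2] by rewrite -eq_xy !inE eqxx.
have y2 : y.2 \in [set x.1; x.2] by rewrite -eq_xy !inE eqxx orbT.
have x1 : x.1 \in [set y.1; y.2] by rewrite eq_xy !inE eqxx.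
have x2 : x.2 \in [set y.1; y.2] by rewrite eq_xy !inE eqxx orbT.
move: y1 y2 x1 x2; rewrite !inE; case: x y {xD eq_xy} => [a b] [c d] /=.
rewrite !xpair_eqE => /orP[]/eqP-> /orP[]/eqP->; rewrite ?orbb !eqxx ?orbT //.
  by move=> _ /eqP->; rewrite eqxx.
by move=> /eqP-> _; rewrite eqxx.
Qed.

Lemma enum_row_basis m n (N : 'M[F]_(m, n)) (B : {set 'I_m}) k :
  #|B| = k -> \rank (row_mask B N) = k -> \rank N = k ->
  exists f : 'I_k -> 'I_m, \rank (rowsub f N) = k /\
    #|mxsupp (rowsub f N)| = (\sum_(i in B) #|[set j | N i j != 0%R]|)%N.
Proof.
move=> cB; move: cB => <- rB rN; exists (enum_val (A := mem B)); split.
  apply/eqP; rewrite eqn_leq rank_leq_row /= -{1}rB; apply: mxrankS.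
  by apply/row_mask_subP => i iB; rewrite -(enum_rankK_in iB iB) -row_rowsub row_sub.
rewrite card_mxsupp [RHS]big_enum_val; apply: eq_bigr => a _.
by apply: eq_card => j; rewrite !inE !mxE.
Qed.

(** On a principal submatrix of least ratio of rank to size, every set of rows or columns has enough
    rank for a sparse basis; comparison with the full matrix bounds that ratio by [r / n]. The
    condition [2 * r <= n] ensures that a fixed proportion of the support is off the diagonal. *)
Lemma sparse_principal_pattern n r (M : 'M[F]_n) :
  (0 < n)%N -> (2 * r <= n)%N -> (forall i, M i i != 0) -> (\rank M <= r)%N ->
  exists S k u, [/\ sparsely_spanned F k u S, S \subset mxsupp M,
     (0 < k)%N, (k <= u)%N /\ (k <= r)%N & (u * n <= #|S| * r)%N] /\
     (#|S| <= 6 * #|offdiag_pairs S|)%N.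
Proof.
move=> n0 rn Mdiag rM.
pose rk (I : {set 'I_n}) : nat := \rank (principal_mask I M).
have T0 : [set: 'I_n] != set0 by rewrite -card_gt0 cardsT card_ord.
have [I I0 Imin] : exists2 I : {set 'I_n}, I != set0 &
    forall A : {set 'I_n}, (rk I * #|A| <= rk A * #|I|)%N.
  pose ratio (I : {set 'I_n}) : rat := (rk I)%:R / #|I|%:R.
  have [I I0 Imin] := @Order.TotalTheory.arg_minP _ _ _ setT (fun I => I != set0) ratio T0.
  exists I => // A; have [->|A0] := eqVneq A set0; first by rewrite cards0 muln0.
  have := Imin A A0; rewrite /ratio ler_pdivrMr ?ltr0n ?card_gt0 // mulrAC.
  by rewrite ler_pdivlMr ?ltr0n ?card_gt0 // -!natrM ler_nat.
have cI0 : (0 < #|I|)%N by rewrite card_gt0.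
pose N := principal_mask I M; pose k := \rank N; pose S := mxsupp N.
have Sdiag i : i \in I -> N i i != 0 by move=> iI; rewrite mxE iI Mdiag.
have supN i j : N i j != 0 -> (i \in I) && (j \in I).
  by rewrite mxE; case: ifP => //; rewrite eqxx.
have kn : (k * n <= r * #|I|)%N.
  have := Imin setT; rewrite cardsT card_ord => /leq_trans; apply.
  by rewrite leq_mul2r /rk principal_maskTT rM orbT.
have k2 : (2 * k <= #|I|)%N.
  rewrite -(leq_pmul2r n0) -mulnA; apply: (@leq_trans (2 * (r * #|I|))).
    by rewrite leq_mul2l kn.
  by rewrite mulnA mulnC leq_mul2l rn orbT.
have k0 : (0 < k)%N.
  rewrite lt0n mxrank_eq0; case/set0Pn: I0 => i iI.
  by apply/negP => /eqP N0; have := Sdiag i iI; rewrite N0 mxE eqxx.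
have dense (A : {set 'I_n}) : A \subset I -> (k * #|A| <= \rank (row_mask A N) * #|I|)%N.
  move=> sAI; apply: leq_trans (Imin A) _.
  by rewrite leq_mul2r rank_principal_mask_le ?orbT.
have maskN : row_mask I N = N := row_mask_principal_mask I M.
have maskNT : row_mask I N^T = N^T by rewrite -principal_maskT row_mask_principal_mask.
pose w (N : 'M[F]_n) i := #|[set j | N i j != 0]|.
have supp_w (N' : 'M[F]_n) : row_mask I N' = N' -> #|mxsupp N'| = (\sum_(i in I) w N' i)%N.
  move=> mN'; rewrite card_mxsupp [LHS](bigID (mem I)) /= [X in (_ + X)%N]big1 ?addn0 //.
  move=> i iI; apply/eqP; rewrite cards_eq0; apply/eqP/setP => j; rewrite !inE -mN' mxE.
  by rewrite (negPf iI) eqxx.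
have basis (N' : 'M[F]_n) : \rank N' = k -> row_mask I N' = N' -> #|mxsupp N'| = #|S| ->
    (forall A : {set 'I_n}, A \subset I ->
      (k * #|A| <= \rank (row_mask A N') * #|I|)%N) ->
    exists B : {set 'I_n}, [/\ B \subset I, #|B| = k, \rank (row_mask B N') = k
      & (\sum_(i in B) w N' i <= #|S| * k %/ #|I|)%N].
  move=> rN' mN' sN' dN'.
  have [|B [sBI rB cB wB]] := @sparse_row_basis _ _ _ N' I (w N').
    by move=> A sAI; rewrite mN' rN'; exact: dN'.
  rewrite mN' rN' in cB wB; exists B; split=> //; first by rewrite rB cB.
  by rewrite leq_divRL // mulnC [leqRHS]mulnC -sN' (supp_w _ mN') mulnC.
have [B [sBI cB rB wB]] := basis N erefl maskN erefl dense.
(* Minimality of the ratio is invariant under transposition, which yields the column basis. *)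
have [B' [sBI' cB' rB' wB']] : exists B : {set 'I_n}, [/\ B \subset I, #|B| = k,
     \rank (row_mask B N^T) = k & (\sum_(i in B) w N^T i <= #|S| * k %/ #|I|)%N].
  apply: basis; rewrite ?mxrank_tr ?card_mxsupp_tr // => A sAI.
  apply: leq_trans (Imin A) _; rewrite leq_mul2r -principal_maskT.
  apply/orP; right; rewrite /rk -mxrank_tr -principal_maskT.
  exact: rank_principal_mask_le.
have [f [rf sf]] := enum_row_basis cB rB erefl.
have [|g [rg sg]] := enum_row_basis cB' rB'; first by rewrite mxrank_tr.
set u := (#|S| * k %/ #|I|)%N in wB wB'.
have gE : colsub g N = (rowsub g N^T)^T by rewrite trmx_mxsub trmxK.
exists S, k, u; split; last first.
  (* A row with a single nonzero entry carries it on the diagonal, so [#|J| <= k <= #|I| / 2]. The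
     other rows have at least two, so [#|S| >= 3 * #|I| / 2] and at least a third of [S] is off the
     diagonal; a pair absorbs at most two entries, whence the factor 6. *)
  pose J := [set i in I | (w N i <= 1)%N].
  have w1 i : i \in I -> (0 < w N i)%N.
    by move=> iI; apply/card_gt0P; exists i; rewrite inE Sdiag.
  have cJ : (#|J| <= k)%N.
    apply: rank_diagonal_rows => i j; rewrite inE => /andP[iI wi].
    have /cards1P[x wx] : w N i == 1%N by rewrite eqn_leq wi w1.
    have /esym/eqP xi : true = (i == x).
      by have /setP/(_ i) := wx; rewrite !inE Sdiag.
    by have /setP/(_ j) := wx; rewrite !inE => ->; rewrite -xi eq_sym.
  have I2 : (2 * #|I| <= #|S| + #|J|)%N.
    rewrite /S (supp_w _ maskN) mulnC -sum_nat_const -[X in (_ + X)%N]sum1_card.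
    have -> : (\sum_(i in J) 1 = \sum_(i in I) (w N i <= 1))%N.
      rewrite (eq_bigl (fun i => (i \in I) && (w N i <= 1)%N)) => [|i]; last by rewrite inE.
      by rewrite big_mkcondr; apply: eq_bigr => i _; case: ifP.
    rewrite -big_split; apply: leq_sum => i iI /=.
    by have := w1 i iI; case: (w N i) => [|[|m]].
  have SI : (#|S| <= #|I| + #|[set x in S | x.1 != x.2]|)%N.
    rewrite -(cardsID [set x | x.1 == x.2] S) leq_add //.
      rewrite -(card_imset I (fun i j (e : (i, i) = (j, j)) => congr1 fst e)).
      apply: subset_leq_card; apply/subsetP => -[i j]; rewrite !inE /=.
      case/andP => Nij /eqP ij; rewrite -ij in Nij *.
      by apply/imsetP; exists i => //; case/andP: (supN _ _ Nij).
    by apply: subset_leq_card; apply/subsetP => x; rewrite !inE andbC.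
  by have := card_offdiag_pairs S; lia.
split=> //.
- exists N, f, g; split=> //; first by rewrite gE mxrank_tr.
  by rewrite gE card_mxsupp_tr sf sg.
- apply/subsetP => x; rewrite !inE => Nx; move: (Nx); rewrite mxE.
  by rewrite (supN _ _ Nx).
- split; last first.
    apply: leq_trans rM; rewrite -(principal_maskTT M).
    exact: rank_principal_mask_sub (subsetT I).
  apply: leq_trans wB; rewrite -cB -sum1_card; apply: leq_sum => i iB.
  by apply/card_gt0P; exists i; rewrite inE Sdiag // (subsetP sBI).
- rewrite -(leq_pmul2r cI0) mulnAC; apply: (@leq_trans (#|S| * k * n)).
    by rewrite leq_mul2r leq_trunc_div orbT.
  by rewrite -!mulnA leq_mul2l kn orbT.
Qed.

End PrincipalPatterns.

(** * Counting copies through a given pair *)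

Section CopyCount.
Variables (T : finType) (e : rel T).

Definition copy_of (n : nat) (Fs : {set {set T}}) (g : T -> 'I_n) : {set {set 'I_n}} :=
  [set g @: A | A : {set T} in Fs].

(** A copy is recorded by its edges alone, while all of [T] is embedded injectively, as in a copy of
    the whole graph. *)
Definition copies (n : nat) (Fs : {set {set T}}) : {set {set {set 'I_n}}} :=
  [set copy_of Fs g | g : {ffun T -> 'I_n} in [pred g : {ffun T -> 'I_n} | injectiveb g]].

Lemma card_copies n (Fs : {set {set T}}) X : X \in copies n Fs -> #|X| = #|Fs|.
Proof.
case/imsetP => g /injectiveP ginj ->; apply: card_imset.
exact: imset_inj.
Qed.

Lemma card_bigcup_le (I J : finType) (P : pred I) (A : I -> {set J}) :
  #|\bigcup_(i | P i) A i| <= \sum_(i | P i) #|A i|.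
Proof.
apply: (big_ind2 (fun (B : {set J}) m => #|B| <= m)); rewrite ?cards0 //.
move=> B1 m1 B2 m2 h1 h2; apply: leq_trans (leq_add h1 h2).
by rewrite leq_card_setU.
Qed.

(* A copy through the edge [p] is determined by the edge [{x, y}] of the
   subgraph mapped onto [p], by the orientation, and by the images of the
   remaining [#|S| - 2] vertices. *)
Lemma card_copies_through n (S : {set T}) (Fs : {set {set T}}) (p : {set 'I_n}) :
  is_subgraph e S Fs ->
  #|[set X in copies n Fs | p \in X]| <= 2 * #|T| ^ 2 * n ^ (#|S| - 2).
Proof.
case/andP => sFe /forall_inP sFS.
have edgeP g : p \in copy_of Fs g -> exists x y : T,
    [/\ x \in S, y \in S, x != y & p = [set (g : T -> 'I_n) x; g y]].
  case/imsetP => A AF ->; have := subsetP sFe A AF; rewrite inE.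
  case/existsP => x /existsP[y /and3P[xy _ /eqP AE]].
  have := sFS A AF; rewrite AE subUset !sub1set => /andP[xS yS].
  by exists x, y; rewrite imsetU1 imset_set1.
have [->|] := eqVneq [set X in copies n Fs | p \in X] set0; first by rewrite cards0.
case/set0Pn => X0; rewrite inE => /andP[/imsetP[g0 _ ->] /edgeP[x0 [y0 [_ _ _ pE]]]].
set a := g0 x0 in pE; set b := g0 y0 in pE.
pose ext (t : T * T * bool) (phi : {ffun T -> 'I_n}) z :=
  if z == t.1.1 then (if t.2 then a else b)
  else if z == t.1.2 then (if t.2 then b else a) else phi z.
pose P (t : T * T * bool) := [&& t.1.1 \in S, t.1.2 \in S & t.1.1 != t.1.2].
pose R (t : T * T * bool) := S :\: [set t.1.1; t.1.2].
apply: (@leq_trans #|\bigcup_(t | P t)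
   [set copy_of Fs (ext t phi) | phi in pffun_on a (mem (R t)) predT]|).
  apply: subset_leq_card; apply/subsetP => X; rewrite inE.
  case/andP => /imsetP[g /injectiveP ginj ->] /edgeP[x [y [xS yS xy pE']]].
  have [o [gx gy]] : exists o : bool, g x = (if o then a else b) /\ g y = (if o then b else a).
    have gxy : g x != g y by apply: contra xy => /eqP/ginj->.
    have ga : a \in [set g x; g y] by rewrite -pE' pE !inE eqxx.
    have gb : b \in [set g x; g y] by rewrite -pE' pE !inE eqxx orbT.
    have gx : g x \in [set a; b] by rewrite -pE pE' !inE eqxx.
    have gy : g y \in [set a; b] by rewrite -pE pE' !inE eqxx orbT.
    move: ga gb gx gy gxy; rewrite !inE.
    move=> /orP[/eqP ga|/eqP ga] /orP[/eqP gb|/eqP gb].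
    - by rewrite ga gb !orbb => _ /eqP->; rewrite eqxx.
    - by exists true; rewrite ga gb.
    - by exists false; rewrite ga gb.
    - by rewrite ga gb !orbb => /eqP->; rewrite eqxx.
  apply/bigcupP; exists (x, y, o); first by rewrite /P /= xS yS.
  (* Outside [R] the map takes the default value [a], so that only the values on the other
     [#|S| - 2] vertices are counted. *)
  apply/imsetP; exists [ffun z => if z \in R (x, y, o) then g z else a].
    apply/pffun_onP; split=> //; apply/subsetP => z; rewrite inE ffunE.
    by case: ifP => //; rewrite eqxx.
  apply: eq_in_imset => A AF; apply: eq_in_imset => z zA.
  have zS : z \in S by apply: (subsetP (sFS A AF)).
  rewrite /ext /=; case: eqP => [->|/eqP zx]; first by rewrite gx.
  case: eqP => [->|/eqP zy]; first by rewrite gy.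
  by rewrite ffunE !inE negb_or zx zy zS.
apply: leq_trans (card_bigcup_le _ _) _.
apply: (@leq_trans (\sum_(t : T * T * bool) n ^ (#|S| - 2))); last first.
  by rewrite sum_nat_const !card_prod card_bool mulnC [in leqRHS](mulnC 2) mulnn mulnC.
rewrite big_mkcond; apply: leq_sum => t _; case: ifP => // /and3P[xS yS xy].
apply: leq_trans (leq_imset_card _ _) _.
rewrite card_pffun_on card_ord leq_eqVlt; apply/orP; left; apply/eqP; congr (_ ^ _).
rewrite cardsDS ?cards2 ?xy //.
by rewrite subUset !sub1set xS yS.
Qed.

End CopyCount.

(** * The union bound over supports *)

Section HighMinrank.
Local Open Scope ring_scope.

(** The smallness hypothesis beats the union bound: at most [n ^ (16 * u)] supports, each missed
    with probability at most [n ^- (24 * u)], leave at most [n ^- 8] for each pair [(k, u)]. *)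
Lemma exists_graph_avoiding (K : realFieldType) (T : finType) (e : rel T)
    (V0 : {set T}) (E0 : {set {set T}}) (F : fieldType) (n r : nat) (q : K) :
  is_subgraph e V0 E0 -> (0 < #|E0|)%N -> (1 < n)%N -> (2 * r <= n)%N -> 0 < q -> q < 1 ->
  (forall m u, (u * n <= 6 * m * r)%N ->
     ((1 - q) * (1 + (q / (1 - q)) ^+ #|E0|) ^+ (2 * #|T| ^ 2 * n ^ (#|V0| - 2))) ^+ m
     <= n%:R ^- (24 * u)) ->
  exists G : rel 'I_n, [/\ simple_graph G, ~ contains_copy e (compl_graph G)
    & forall M : 'M[F]_n, fits G M -> (r < \rank M)%N].
Proof.
move=> sub0 E0gt n1 rn q0 q1; have n0 := ltnW n1.
set D := (2 * _ * _)%N; set beta := (1 - q) * _ => small.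
have beta0 : 0 <= beta.
  have p0 : 0 <= 1 - q by rewrite subr_ge0 ltW.
  by rewrite mulr_ge0 // exprn_ge0 // addr_ge0 // exprn_ge0 // divr_ge0 // ltW.
(* The ranges [k <= n] and [u <= n * n] contain every pair that arises and keep the union finite. *)
pose good (ku : 'I_n.+1 * 'I_(n * n).+1) (S : {set 'I_n * 'I_n}) := `[<
   sparsely_spanned F ku.1 ku.2 S /\ (ku.2 * n <= 6 * #|offdiag_pairs S| * r)%N>].
pose valid (ku : 'I_n.+1 * 'I_(n * n).+1) := (0 < ku.1)%N && (ku.1 <= ku.2)%N.
pose P S := [exists ku, valid ku && good ku S].
have sumP : \sum_(S | P S) beta ^+ #|offdiag_pairs S| < 1.
  apply: (@le_lt_trans _ _ (\sum_(ku | valid ku) \sum_(S | good ku S)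
      beta ^+ #|offdiag_pairs S|)).
    apply: union_bound => [S|S /existsP[ku /andP[]]]; first exact: exprn_ge0.
    by exists ku.
  have nK0 : (0 : K) < n%:R by rewrite ltr0n.
  have le_ku ku : valid ku ->
      \sum_(S | good ku S) beta ^+ #|offdiag_pairs S| <= n%:R ^- 8 :> K.
    case/andP => k0 ku1; have u0 := leq_trans k0 ku1.
    apply: (@le_trans _ _ (\sum_(S | good ku S) n%:R ^- (24 * ku.2))).
      by apply: ler_sum => S /asboolP[_]; exact: small.
    rewrite sumr_const -[leLHS]mulr_natl.
    have card_good : (#|good ku| <= n ^ (16 * ku.2))%N.
      have -> : #|good ku| = #|[set S | good ku S]| by rewrite cardsE.
      apply: (@card_sparsely_spanned F n ku.1 ku.2) => //.
        by rewrite -ltnS.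
      by move=> S; rewrite inE => /asboolP[].
    apply: (@le_trans _ _ ((n ^ (16 * ku.2))%:R / n%:R ^+ (24 * ku.2))).
      by rewrite ler_pM2r ?invr_gt0 ?exprn_gt0 // ler_nat.
    rewrite natrX ler_pdivrMr ?exprn_gt0 // mulrC ler_pdivlMr ?exprn_gt0 //.
    by rewrite -exprD ler_eXn2l ?ltr1n //; lia.
  apply: le_lt_trans (ler_sum _ le_ku) _.
  rewrite sumr_const -[ltLHS]mulr_natl ltr_pdivrMr ?exprn_gt0 // mul1r -natrX ltr_nat.
  apply: leq_ltn_trans (max_card _) _; rewrite card_prod !card_ord.
  (* There are at most [n ^ 5] pairs [(k, u)], fewer than [n ^ 8]. *)
  apply: (@leq_ltn_trans (n ^ 2 * n ^ 3)); last by rewrite -expnD ltn_exp2l.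
  have h1 : (n < n ^ 2)%N by rewrite -{1}(expn1 n) ltn_exp2l.
  have h2 : (n * n < n ^ 3)%N by rewrite mulnn ltn_exp2l.
  exact: leq_mul.
have [Q [Qfree Qhit]] := @hitting_set_avoiding K {set 'I_n} {set 'I_n * 'I_n}
  (copies n E0) P (@offdiag_pairs n) #|E0| D q q0 q1 E0gt
  (@card_copies _ n E0) (fun S p _ _ => card_copies_through p sub0) sumP.
pose G : rel 'I_n := fun i j => (i != j) && ([set i; j] \notin Q).
have complG i j : compl_graph G i j = (i != j) && ([set i; j] \in Q).
  by rewrite /compl_graph /G; case: eqVneq => //= _; rewrite negbK.
exists G; split.
- by split=> [i j|i]; rewrite /G ?eqxx // eq_sym setUC.
- case=> f [finj fe]; case/andP: sub0 => sE0 _.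
  (* A copy of the whole graph contains a copy of its subgraph [E0], and none of these lies in
     [Q]. *)
  have /Qfree/negP : copy_of E0 (finfun f) \in copies n E0.
    by apply/imsetP; exists (finfun f) => //; apply/injectiveP => x y; rewrite !ffunE => /finj.
  apply.
  apply/subsetP => p /imsetP[A AE0 ->].
  have := subsetP sE0 A AE0; rewrite inE => /existsP[x /existsP[y /and3P[_ exy /eqP->]]].
  by have := fe x y exy; rewrite complG => /andP[_]; rewrite imsetU1 imset_set1 !ffunE.
- move=> M [Mdiag Msupp]; rewrite ltnNge; apply/negP => rM.
  have [S [k [u [[spS sS k0 [ku kr] uS] cS]]]] := sparse_principal_pattern n0 rn Mdiag rM.
  have un : (u * n <= 6 * #|offdiag_pairs S| * r)%N.
    by apply: leq_trans uS _; rewrite leq_mul2r cS orbT.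
  have u_lt : (u < (n * n).+1)%N.
    rewrite ltnS -(leq_pmul2r n0); apply: leq_trans uS _; apply: leq_mul; last by lia.
    by apply: leq_trans (max_card _) _; rewrite card_prod card_ord.
  have k_lt : (k < n.+1)%N by lia.
  have PS : P S.
    apply/existsP; exists (Ordinal k_lt, Ordinal u_lt).
    by rewrite /valid /= k0 ku /=; apply/asboolP.
  (* [Q] contains a pair coming from the support of [M], but [M] vanishes at pairs nonadjacent in
     [G]. *)
  have [p pQ /imsetP[x]] := Qhit S PS; rewrite inE => /andP[xS x12] pE.
  have := subsetP sS x xS; rewrite inE Msupp ?eqxx //.
  by rewrite /G x12 /= negbK -pE.
Qed.

End HighMinrank.

(** * Real estimates and the choice of the density *)

Local Open Scope R_scope.

Lemma le_bigRmax (I : finType) (P : pred I) (w : I -> R) (i : I) :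
  P i -> w i <= \big[Rmax/0]_(j | P j) w j.
Proof.
move=> Pi; have := mem_index_enum i; elim: (index_enum I) => // j s IHs.
rewrite inE big_cons => /orP[/eqP<-|/IHs le_s]; first by rewrite Pi; exact: Rmax_l.
by case: ifP => // _; apply: Rle_trans le_s (Rmax_r _ _).
Qed.

(** The fold returns its starting value 0 or one of the terms; positivity excludes the first
    case. *)
Lemma bigRmax_attained (I : finType) (P : pred I) (w : I -> R) :
  0 < \big[Rmax/0]_(j | P j) w j ->
  exists2 i, P i & \big[Rmax/0]_(j | P j) w j = w i.
Proof.
have [zero|//] : \big[Rmax/0]_(j | P j) w j = 0 \/
    exists2 i, P i & \big[Rmax/0]_(j | P j) w j = w i; last by rewrite zero; lra.
apply: (big_ind (fun x => x = 0 \/ exists2 i, P i & x = w i)).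
- by left.
- by move=> a b ha hb; apply: (Rmax_case a b (fun c => c = 0 \/ exists2 i, P i & c = w i)).
- by move=> i Pi; right; exists i.
Qed.

(** The full graph has two edges, hence positive density, so the maximum is positive; positive
    density in turn forces two edges in the subgraph attaining it. *)
Lemma m2_attained (T : finType) (e : rel T) :
  (3 <= #|T|)%N -> (2 <= #|edge_set e|)%N ->
  exists (S : {set T}) (E : {set {set T}}), [/\ (3 <= #|S|)%N, is_subgraph e S E, (2 <= #|E|)%N
    & m2 e = dens2 S E].
Proof.
move=> hT hE.
have dens_pos (S : {set T}) (E : {set {set T}}) :
    (3 <= #|S|)%N -> 0 < dens2 S E <-> (2 <= #|E|)%N.
  move=> /ssrnat.leP /le_INR hS; rewrite /= in hS.
  have d0 : 0 < / (INR #|S| - 2) by apply: Rinv_0_lt_compat; lra.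
  rewrite /dens2 /Rdiv; split=> [h|/ssrnat.leP /le_INR /= h]; last first.
    by apply: Rmult_lt_0_compat => //; lra.
  have h1 : 0 < INR #|E| - 1.
    by apply: (Rmult_lt_reg_r (/ (INR #|S| - 2))) => //; rewrite Rmult_0_l.
  by apply/ssrnat.ltP; apply: INR_lt; apply: Rminus_gt_0_lt.
pose P (p : {set T} * {set {set T}}) := (3 <= #|p.1|)%N && is_subgraph e p.1 p.2.
have m2E : m2 e = \big[Rmax/0]_(p | P p) dens2 p.1 p.2 by [].
have PT : P ([set: T], edge_set e).
  by rewrite /P /is_subgraph /= cardsT hT subxx /=; apply/forall_inP => A _; exact: subsetT.
have pos : 0 < \big[Rmax/0]_(p | P p) dens2 p.1 p.2.
  apply: Rlt_le_trans (le_bigRmax (fun p => dens2 p.1 p.2) PT) => /=.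
  by apply/dens_pos; rewrite ?cardsT.
have [[S E] /andP[/= S3 sub] mE] := bigRmax_attained pos.
by exists S, E; split=> //; apply/(dens_pos S E S3); rewrite -mE.
Qed.

Lemma exp_pow_INR (x : R) (k : nat) : exp x ^ k = exp (x * INR k).
Proof.
elim: k => [|k IHk]; first by rewrite /= Rmult_0_r exp_0.
by rewrite S_INR Rmult_plus_distr_l Rmult_1_r exp_plus -IHk /= Rmult_comm.
Qed.

(** Follows from [1 + x <= exp x] at [x = - q] and [x = (2 * q) ^ f], with [q / (1 - q) <= 2 * q];
    the deletion costs at most half of the exponent [q]. *)
Lemma failure_base_le_exp (q : R) (f D : nat) :
  0 < q -> q <= / 2 -> (2 * q) ^ f * INR D <= q / 2 ->
  0 <= (1 - q) * (1 + (q / (1 - q)) ^ f) ^ D <= exp (- (q / 2)).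
Proof.
move=> q0 q2 hD.
have p0 : 0 < 1 - q by lra.
have r0 : 0 <= q / (1 - q) by apply: Rlt_le; apply: Rdiv_lt_0_compat; lra.
have r2 : q / (1 - q) <= 2 * q.
  apply: (Rmult_le_reg_r (1 - q)) => //; rewrite /Rdiv Rmult_assoc Rinv_l; last lra.
  by nra.
have x0 : 0 <= (q / (1 - q)) ^ f by apply: pow_le.
have x1 : (q / (1 - q)) ^ f <= (2 * q) ^ f by apply: pow_incr.
split; first by apply: Rmult_le_pos; [lra|apply: pow_le; lra].
apply: (Rle_trans _ (exp (- q) * exp ((2 * q) ^ f * INR D))); last first.
  rewrite -exp_plus; have [lt|->] : - q + (2 * q) ^ f * INR D < - (q / 2) \/
     - q + (2 * q) ^ f * INR D = - (q / 2) by lra.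
    by apply: Rlt_le; exact: exp_increasing.
  exact: Rle_refl.
apply: Rmult_le_compat; first by lra.
- by apply: pow_le; lra.
- by have := exp_ineq1_le (- q); lra.
rewrite -exp_pow_INR; apply: pow_incr; split; first by lra.
by have := exp_ineq1_le ((2 * q) ^ f); lra.
Qed.

(** The exponent [q * m / 2] must reach [24 * u * ln n]. As [u <= 6 * m * r / n], it is enough that
    [288 * r * ln n <= q * n], where [288 = 2 * 6 * 24]. *)
Lemma failure_power_bound (q : R) (f D n r m u : nat) :
  0 < q -> q <= / 2 -> (2 * q) ^ f * INR D <= q / 2 -> (1 < n)%N ->
  288 * INR r * ln (INR n) <= q * INR n -> (u * n <= 6 * m * r)%N ->
  ((1 - q) * (1 + (q / (1 - q)) ^ f) ^ D) ^ m <= / INR n ^ (24 * u).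
Proof.
move=> q0 q2 hD n1 hr hu.
have n2 : 2 <= INR n by have /ssrnat.leP/le_INR := n1.
have L0 : 0 < ln (INR n) by rewrite -ln_1; apply: ln_increasing; lra.
have [b0 b1] := failure_base_le_exp q0 q2 hD.
apply: (Rle_trans _ (exp (- (q / 2)) ^ m)); first by apply: pow_incr.
rewrite exp_pow_INR -{1}(exp_ln (INR n)); last by lra.
rewrite exp_pow_INR -exp_Ropp.
have key : ln (INR n) * INR (24 * u) <= q / 2 * INR m.
  have [r0|r0] := posnP r.
    move: hu; rewrite r0 muln0 leqn0 muln_eq0 (gtn_eqF (ltnW n1)) orbF => /eqP->.
    by rewrite muln0 /= Rmult_0_r; have := pos_INR m; nra.
  have r1 : 1 <= INR r by have /ssrnat.leP/le_INR := r0.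
  have m0 := pos_INR m; have u0 := pos_INR u.
  have hu' : INR u * INR n <= 6 * INR m * INR r.
    by have /ssrnat.leP/le_INR := hu; rewrite !mult_INR /=; lra.
  have -> : INR (24 * u) = 24 * INR u by rewrite mult_INR /=; lra.
  apply: (Rmult_le_reg_r (INR r)); first by lra.
  have h1 : INR u * (288 * INR r * ln (INR n)) <= INR u * (q * INR n).
    by apply: Rmult_le_compat_l.
  have h2 : q * (INR u * INR n) <= q * (6 * INR m * INR r) by apply: Rmult_le_compat_l; lra.
  by lra.
have [lt|eq] : - (q / 2) * INR m < - (ln (INR n) * INR (24 * u)) \/
    - (q / 2) * INR m = - (ln (INR n) * INR (24 * u)) by lra.
  by apply: Rlt_le; exact: exp_increasing.
by rewrite eq; exact: Rle_refl.
Qed.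

Lemma nat_floor_ex (x : R) : 0 <= x -> exists r, INR r <= x < INR r + 1.
Proof.
move=> x0; have [up1 up2] := archimed x.
have up0 : Z.lt 0 (up x) by apply: lt_IZR; lra.
have [|r rE] := IZN (up x - 1); first by lia.
by exists r; rewrite INR_IZR_INZ -rE minus_IZR; lra.
Qed.

Lemma Rpower_INR_pow (x y : R) (k : nat) : 0 < x -> Rpower x y ^ k = Rpower x (y * INR k).
Proof. by move=> x0; rewrite -Rpower_mult Rpower_pow //; exact: exp_pos. Qed.

(* [q = eps * n ^ (- 1 / m2)] makes the expected number of copies through a
   given pair at most a small constant. *)
Lemma copy_expectation_bound (A f h n : nat) (q : R) :
  (0 < A)%N -> (2 <= f)%N -> (3 <= h)%N -> (1 < n)%N ->
  q = / (2 ^ f.+1 * INR A) * Rpower (INR n) (- ((INR h - 2) / (INR f - 1))) ->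
  [/\ 0 < q, q <= / 2 & (2 * q) ^ f * INR (A * n ^ (h - 2)) <= q / 2].
Proof.
move=> A0 f2 h3 n1 qE.
have n2 : 2 <= INR n by have /ssrnat.leP/le_INR := n1.
have A1 : 1 <= INR A by have /ssrnat.leP/le_INR := A0.
have f2' : 2 <= INR f by have /ssrnat.leP/le_INR := f2.
have h3' : 3 <= INR h by have /ssrnat.leP/le_INR := h3; rewrite /=; lra.
set al := (INR h - 2) / (INR f - 1) in qE.
have al0 : 0 < al by apply: Rdiv_lt_0_compat; lra.
have P0 : 0 < Rpower (INR n) (- al) by exact: exp_pos.
have P1 : Rpower (INR n) (- al) <= 1.
  rewrite -(Rpower_O (INR n)); last lra.
  by apply: Rle_Rpower; lra.
(* Chosen so that [2 ^ f * A * eps = 1/2], the factor in the final bound [q / 2]. *)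
set eps := / (2 ^ f.+1 * INR A) in qE.
have pf : 2 <= 2 ^ f.
  by rewrite -{1}(pow_1 2); apply: Rle_pow; [lra|apply/ssrnat.leP; exact: ltnW].
have E0 : 0 < 2 ^ f.+1 * INR A by rewrite /=; nra.
have eps0 : 0 < eps by exact: Rinv_0_lt_compat.
have epsE : eps * (2 ^ f.+1 * INR A) = 1 by rewrite /eps Rinv_l //; lra.
have eps2 : eps <= / 2.
  by apply: Rinv_le_contravar; [lra|rewrite /=; nra].
have q0 : 0 < q by rewrite qE; exact: Rmult_lt_0_compat.
have qeps : q <= eps by rewrite qE; nra.
split=> //; first by lra.
have fE : f = (f.-1).+1 by case: (f) f2.
have hE : INR (h - 2) = INR h - 2 by rewrite minus_INR //; apply/ssrnat.leP; exact: ltnW.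
have f1E : INR f.-1 = INR f - 1 by rewrite {2}fE S_INR; lra.
(* The power of [n] in [q ^ f.-1] cancels [n ^ (h - 2)]; what remains is [eps ^ f.-1], at most [eps]
   because [f >= 2]. *)
have powq : q ^ f.-1 * INR n ^ (h - 2) <= eps.
  rewrite qE Rpow_mult_distr Rpower_INR_pow; last lra.
  have -> : - al * INR f.-1 = - INR (h - 2).
    by rewrite f1E hE /al; field; lra.
  rewrite Rpower_Ropp Rpower_pow; last lra.
  have N0 : 0 < INR n ^ (h - 2) by apply: pow_lt; lra.
  rewrite Rmult_assoc Rinv_l ?Rmult_1_r; last lra.
  have -> : f.-1 = (f.-2).+1 by case: (f) f2 => [|[]].
  rewrite /= -[X in _ <= X]Rmult_1_r; apply: Rmult_le_compat_l; first lra.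
  by rewrite -(pow1 f.-2); apply: pow_incr; lra.
have nE : INR (n ^ (h - 2))%N = INR n ^ (h - 2).
  by elim: (h - 2)%N => // k IHk; rewrite expnS mult_INR IHk.
rewrite Rpow_mult_distr {2}fE [q ^ _]/= mult_INR nE.
have -> : 2 ^ f * (q * q ^ f.-1) * (INR A * INR n ^ (h - 2)) =
   q * (2 ^ f * INR A * (q ^ f.-1 * INR n ^ (h - 2))) by ring.
rewrite /Rdiv; apply: Rmult_le_compat_l; first lra.
have FA : 0 < 2 ^ f * INR A by nra.
apply: (Rle_trans _ (2 ^ f * INR A * eps)); first by apply: Rmult_le_compat_l; lra.
by rewrite /= in epsE; lra.
Qed.

(** * Passage to minrank and final choice of constants *)

Lemma minrank_gt (F : fieldType) (n r : nat) (G : rel 'I_n) :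
  (forall M : 'M[F]_n, fits G M -> (r < \rank M)%N) -> (r < minrank F G)%N.
Proof.
move=> h; rewrite /minrank; case: ex_minnP => m + _; rewrite /has_fit_rank.
case: excluded_middle_informative => // fit _.
by have [M [fM <-]] := fit; exact: h.
Qed.

Theorem theorem5p3 (T : finType) (e : rel T)
  (He : simple_graph e) (hT : (3 <= #|T|)%N) (hE : (2 <= #|edge_set e|)%N) :
  exists c : R, Rlt 0 c /\
    forall (F : fieldType) (n : nat), (2 <= n)%N ->
      exists G : rel 'I_n, simple_graph G /\
        ~ contains_copy e (compl_graph G) /\
        Rle (Rdiv (Rmult c (Rpower (INR n) (Rminus 1 (Rdiv 1 (m2 e)))))
                  (ln (INR n)))
            (INR (minrank F G)).
Proof.
have [V0 [E0 [V3 sub0 E2 m2E]]] := m2_attained hT hE.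
set f := #|E0| in E2 m2E; set h := #|V0| in V3.
(* [A * n ^ (h - 2)] bounds the number of copies through a pair; [A] and [eps] depend neither on [n]
   nor on the field. *)
pose A := (2 * #|T| ^ 2)%N.
have A0 : (0 < A)%N by rewrite muln_gt0 expn_gt0 (leq_trans _ hT).
pose eps := (/ (2 ^ f.+1 * INR A)).
have epos : (0 < eps).
  apply: Rinv_0_lt_compat; apply: Rmult_lt_0_compat; first by apply: pow_lt; lra.
  by apply: lt_0_INR; apply/ssrnat.ltP.
exists (eps / 288); split; first by lra.
move=> F n n1.
have n2 : (2 <= INR n) by have /ssrnat.leP/le_INR := n1.
have f2' : (2 <= INR f) by have /ssrnat.leP/le_INR := E2.
have h3' : (3 <= INR h) by have /ssrnat.leP/le_INR := V3; rewrite /=; lra.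
have L2 : (/ 2 < ln (INR n)).
  apply: Rlt_le_trans ln_lt_2 _.
  have [lt|<-] : (2 < INR n \/ 2 = INR n) by lra.
    by left; apply: ln_increasing; lra.
  by right.
pose al := ((INR h - 2) / (INR f - 1)).
have m2inv : (1 / m2 e = al) by rewrite m2E /dens2 -/f -/h /al; field; lra.
pose q := (eps * Rpower (INR n) (- al)).
have [q0 q2 qD] := @copy_expectation_bound A f h n q A0 E2 V3 n1 erefl.
have qn0 : (0 <= q * INR n / (288 * ln (INR n))).
  by apply: Rlt_le; apply: Rdiv_lt_0_compat; [apply: Rmult_lt_0_compat|]; lra.
(* [r] is the floor of the claimed bound, so excluding ranks up to [r] gives minrank at least
   [r + 1], above the bound. *)
have [r [r1 r2]] := nat_floor_ex qn0.
have rq : (288 * INR r * ln (INR n) <= q * INR n).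
  have := Rmult_le_compat_r (288 * ln (INR n)) _ _ _ r1.
  rewrite /Rdiv Rmult_assoc Rinv_l; last lra.
  by rewrite Rmult_1_r => H; have := H ltac:(lra); lra.
(* From [rq] with [q <= 1/2] and [ln n > 1/2]. *)
have rn : (2 * r <= n)%N.
  apply/ssrnat.leP; apply: INR_le; rewrite mult_INR /=.
  by have := pos_INR r; nra.
have q1 : (q < 1) by lra.
have small m u : (u * n <= 6 * m * r)%N ->
  (((1 - q) * (1 + (q / (1 - q)) ^ f) ^ (A * n ^ (h - 2))) ^ m <= / INR n ^ (24 * u)).
  exact: failure_power_bound.
have [|||G [Gs GH Gr]] := @exists_graph_avoiding R T e V0 E0 F n r q sub0 (ltnW E2) n1 rn.
- by apply/RltP.
- by apply/RltP.
- move=> m u /small le_mu; apply/RleP.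
  by move: le_mu; rewrite !RpowE INRE.
exists G; split=> //; split=> //.
have /ssrnat.leP/le_INR := minrank_gt Gr; rewrite S_INR => Gr'.
rewrite m2inv /Rminus Rpower_plus Rpower_1; last lra.
have -> : (eps / 288 * (INR n * Rpower (INR n) (- al)) / ln (INR n) =
   q * INR n / (288 * ln (INR n))) by rewrite /q; field; lra.
by lra.
Qed.
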